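(* Let $\mathcal{X}$ be a metric family with a decomposition $X=X_0\cup X_1$ for each $X\in\mathcal{X}$, let $\mathcal{X}_0=\{X_0\}_{X\in\mathcal{X}}$, let $\mathcal{Y}$ be a metric family with finite asymptotic dimension, and let $F\colon\mathcal{X}_0\to\mathcal{Y}$ be a coarse map. Then there are a metric family $\mathcal{Y}'$ with finite asymptotic dimension, a coarse embedding $\Theta\colon\mathcal{Y}\to\mathcal{Y}'$ and a coarse map $F'\colon\mathcal{X}\to\mathcal{Y}'$ such that $\Theta\circ F$ is close to the restriction $F'|_{\mathcal{X}_0}\colon\mathcal{X}_0\to\mathcal{Y}'$.
   Context: A metric family is a set of metric spaces. A map of metric families $F\colon\mathcal{X}\to\mathcal{Y}$ is a collection of functions $f\colon X\to Y$ with $X\in\mathcal{X}$, $Y\in\mathcal{Y}$, such that each element of $\mathcal{X}$ is the domain of at least one function in $F$. The composition $G\circ F$ is $\{g\circ f\mid f\in F, g\in G,\ \text{the domain of } g \text{ is the range (codomain) of } f\}$. $F$ is coarse if there is a non-decreasing function $\rho\colon[0,\infty)\to[0,\infty)$ with $d_Y(f(x),f(y))\le\rho(d_X(x,y))$ for all $f\colon X\to Y$ in $F$ and $x,y\in X$. $F$ is effectively proper if there is a proper non-decreasing $\delta\colon[0,\infty)\to[0,\infty)$ with $\delta(d_X(x,y))\le d_Y(f(x),f(y))$ for all such $f,x,y$. $F$ is a coarse embedding if it is coarse and effectively proper. $F$ is close to $F'\colon\mathcal{X}\to\mathcal{Y}$ if there is $C\ge0$ such that for every $f\colon X\to Y$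 in $F$ (respectively, in $F'$) there is $h\colon X\to Y$ in $F'$ (respectively, in $F$) with $d_Y(f(x),h(x))\le C$ for all $x\in X$. A metric family is bounded if the diameters of its members are uniformly bounded. $\operatorname{asdim}(\mathcal{X})\le n$ means: for every $r>0$, each $X\in\mathcal{X}$ has a decomposition $X=X_0\cup\dots\cup X_n$ where each $X_i$ is a union of subspaces $X_{ij}$, $j\in J_i$, with $d(x,y)>r$ whenever $x\in X_{ij}$, $y\in X_{ij'}$, $j\ne j'$, such that the family of all $X_{ij}$ (over all $X\in\mathcal{X}$, $0\le i\le n$, $j\in J_i$) is bounded. $\mathcal{X}$ has finite asymptotic dimension if $\operatorname{asdim}(\mathcal{X})\le n$ for some $n$. *)

(* Defs.v *)
(* Standard-library world: metric spaces are [Rlimit.Metric_Space] over the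
   classical reals [R]. *)
From Stdlib Require Import Reals Classical.
From Stdlib Require Fin.
Open Scope R_scope.
Set Implicit Arguments.

Coercion Base : Metric_Space >-> Sortclass.

Lemma subspace_dist_refl (M : Metric_Space) (P : M -> Prop) (x y : {z : M | P z}) :
  dist M (proj1_sig x) (proj1_sig y) = 0 <-> x = y.
Proof.
split.
- intros H; apply dist_refl in H.
  destruct x as [x Hx], y as [y Hy]; simpl in H; subst y.
  now rewrite (proof_irrelevance _ Hx Hy).
- intros ->; now apply dist_refl.
Qed.

Definition subspace (M : Metric_Space) (P : M -> Prop) : Metric_Space :=
  Build_Metric_Space {z : M | P z}
    (fun x y => dist M (proj1_sig x) (proj1_sig y))
    (fun x y => dist_pos M (proj1_sig x) (proj1_sig y))
    (fun x y => dist_sym M (proj1_sig x) (proj1_sig y))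
    (@subspace_dist_refl M P)
    (fun x y z => dist_tri M (proj1_sig x) (proj1_sig y) (proj1_sig z)).

(* A set of metric spaces, given as an indexed family; repetitions are allowed,
   and "the same member" means "the same index". *)
Record metric_family := MetricFamily {
  index :> Type;
  member :> index -> Metric_Space
}.

Definition subspace_family (X : metric_family) (P : forall i : X, X i -> Prop)
    : metric_family :=
  MetricFamily (fun i : X => subspace (X i) (P i)).

(* [F i j f] means that [f], with domain [X i] and codomain [Y j], belongs to
   the collection [F]. *)
Record family_map (X Y : metric_family) := FamilyMap {
  map_in :> forall (i : X) (j : Y), (X i -> Y j) -> Prop;
  map_total : forall i : X, exists (j : Y) (f : X i -> Y j), map_in i j f
}.

Section Operations.
Variables X Y Z : metric_family.

Definition comp_in (G : family_map Y Z) (F : family_map X Y)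
    (i : X) (k : Z) (h : X i -> Z k) : Prop :=
  exists (j : Y) (f : X i -> Y j) (g : Y j -> Z k),
    F i j f /\ G j k g /\ h = (fun x => g (f x)).

Lemma comp_total (G : family_map Y Z) (F : family_map X Y) (i : X) :
  exists (k : Z) (h : X i -> Z k), comp_in G F i k h.
Proof.
destruct (map_total F i) as [j [f Hf]].
destruct (map_total G j) as [k [g Hg]].
now exists k, (fun x => g (f x)), j, f, g.
Qed.

Definition family_comp (G : family_map Y Z) (F : family_map X Y) : family_map X Z :=
  FamilyMap X Z (comp_in G F) (comp_total G F).

Variable P : forall i : X, X i -> Prop.

Definition restrict_in (F : family_map X Y)
    (i : subspace_family X P) (j : Y) (h : subspace_family X P i -> Y j) : Prop :=
  exists f : X i -> Y j, F i j f /\ h = (fun x => f (proj1_sig x)).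
Arguments restrict_in F i j h : clear implicits.

Lemma restrict_total (F : family_map X Y) (i : subspace_family X P) :
  exists (j : Y) (h : subspace_family X P i -> Y j), restrict_in F i j h.
Proof.
destruct (map_total F i) as [j [f Hf]].
now exists j, (fun x => f (proj1_sig x)), f.
Qed.

Definition family_restrict (F : family_map X Y) : family_map (subspace_family X P) Y :=
  FamilyMap (subspace_family X P) Y (restrict_in F) (restrict_total F).

End Operations.

(* [rho] restricts to a non-decreasing function from [0,oo) to [0,oo); its
   values at negative arguments are irrelevant. *)
Definition control_function (rho : R -> R) : Prop :=
  (forall t, 0 <= t -> 0 <= rho t) /\
  (forall s t, 0 <= s -> s <= t -> rho s <= rho t).

(* Preimages of bounded subsets of [0,oo) are bounded. *)
Definition proper (delta : R -> R) : Prop :=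
  forall M, exists N, forall t, 0 <= t -> delta t <= M -> t <= N.

Section Maps.
Variables X Y : metric_family.

Definition coarse (F : family_map X Y) : Prop :=
  exists rho : R -> R, control_function rho /\
    forall (i : X) (j : Y) (f : X i -> Y j), F i j f ->
      forall x y : X i, dist (Y j) (f x) (f y) <= rho (dist (X i) x y).

Definition effectively_proper (F : family_map X Y) : Prop :=
  exists delta : R -> R, control_function delta /\ proper delta /\
    forall (i : X) (j : Y) (f : X i -> Y j), F i j f ->
      forall x y : X i, delta (dist (X i) x y) <= dist (Y j) (f x) (f y).

Definition coarse_embedding (F : family_map X Y) : Prop :=
  coarse F /\ effectively_proper F.

Definition close (F F' : family_map X Y) : Prop :=
  exists C : R, 0 <= C /\
    (forall (i : X) (j : Y) (f : X i -> Y j), F i j f ->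
       exists h : X i -> Y j, F' i j h /\
         forall x : X i, dist (Y j) (f x) (h x) <= C) /\
    (forall (i : X) (j : Y) (f : X i -> Y j), F' i j f ->
       exists h : X i -> Y j, F i j h /\
         forall x : X i, dist (Y j) (f x) (h x) <= C).

End Maps.

Definition bounded_family (X : metric_family) : Prop :=
  exists D : R, forall (i : X) (x y : X i), dist (X i) x y <= D.

(* The family of all the pieces [U i k j] of the members [X i], where the
   "colour" [k] ranges over the [n + 1] elements of [Fin.t (S n)]. *)
Definition pieces (X : metric_family) (n : nat)
    (J : forall i : X, Fin.t (S n) -> Type)
    (U : forall (i : X) (k : Fin.t (S n)), J i k -> X i -> Prop)
    : metric_family :=
  @MetricFamily {i : X & {k : Fin.t (S n) & J i k}}
    (fun a => subspace (X (projT1 a))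
       (U (projT1 a) (projT1 (projT2 a)) (projT2 (projT2 a)))).

Definition asdim_le (X : metric_family) (n : nat) : Prop :=
  forall r : R, 0 < r ->
    exists (J : forall i : X, Fin.t (S n) -> Type)
           (U : forall (i : X) (k : Fin.t (S n)), J i k -> X i -> Prop),
      (forall (i : X) (x : X i), exists (k : Fin.t (S n)) (j : J i k), U i k j x) /\
      (forall (i : X) (k : Fin.t (S n)) (j j' : J i k) (x y : X i),
         j <> j' -> U i k j x -> U i k j' y -> dist (X i) x y > r) /\
      bounded_family (pieces X J U).

Definition finite_asdim (X : metric_family) : Prop :=
  exists n : nat, asdim_le X n.

(* Main.v *)
Require Import Defs.
From Stdlib Require Import Reals Lra Lia Arith Classical ClassicalEpsilon.
From Stdlib Require Fin.
Open Scope R_scope.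

(** The target [Y'] consists of horoballs.  Over a metric space [M] put the
    points [(y, s)] with [y] in [M] and a height [s]; to travel from [(y, s)] to
    [(z, t)] one climbs to a height [v] at which [y] and [z] are next to each
    other, meaning [dist M y z <= A v] for a fixed fast growing [A], and comes
    down again, at total cost [2 * v - s - t].  Here [M] sits at height [0], and
    it is coarsely embedded however fast [A] grows.

    Heights make coarse maps extend: with [X0] inside [X] and [f] defined on
    [X0], send [x] to [(f (p x), h x)], where [h x] is the least integer such
    that some point [p x] of [X0] is within [h x] of [x].  The points [p x] and
    [p x'] are at distance at most [h x + h x' + dist x x'].  If [A v]
    dominates the control function of [f] at [2 * v], then [f (p x)] and
    [f (p x')] are next to each other at half that number as height, so the
    journey between the two images costs [dist x x'] up to a constant
    ([coarse_map_extends]).  On [X0] the height is [0], so this is an exact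
    extension.

    The horoballs have finite asymptotic dimension because [A] may also be
    chosen to dominate the diameters of the pieces into which [Y] decomposes at
    scale [A m].  Cut the heights into long bands.  Bands of equal parity are far
    apart, and within one band a single decomposition of [Y], at the scale
    belonging to a height slightly above the band, gives far apart pieces of
    uniformly bounded diameter.  So two copies of the colours of [Y] are enough
    ([horoball_family_asdim_le]).

    A member of [Y] can be empty while the member of [X] mapped to it is not,
    when the subset [X0] of the latter is empty.  A one-point space is added to
    the target to receive these maps. *)

(** * Decompositions at one scale *)

Definition decomposes (Y : metric_family) (n : nat) (r D : R)
    (J : forall i : Y, Fin.t (S n) -> Type)
    (U : forall (i : Y) (k : Fin.t (S n)), J i k -> Y i -> Prop) : Prop :=
  (forall (i : Y) (x : Y i), exists (k : Fin.t (S n)) (j : J i k), U i k j x) /\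
  (forall (i : Y) (k : Fin.t (S n)) (j j' : J i k) (x y : Y i),
     j <> j' -> U i k j x -> U i k j' y -> dist (Y i) x y > r) /\
  (forall (i : Y) (k : Fin.t (S n)) (j : J i k) (x y : Y i),
     U i k j x -> U i k j y -> dist (Y i) x y <= D).

Lemma asdim_le_iff (Y : metric_family) (n : nat) :
  asdim_le Y n <->
  forall r, 0 < r -> exists D J U, decomposes Y n r D J U.
Proof.
split; intros H r Hr; specialize (H r Hr).
- destruct H as (J & U & Hcov & Hsep & D & HD).
  exists D, J, U; repeat split; trivial.
  intros i k j x y Hx Hy.
  exact (HD (existT _ i (existT _ k j)) (exist _ x Hx) (exist _ y Hy)).
- destruct H as (D & J & U & Hcov & Hsep & HD).
  exists J, U; repeat split; trivial.
  exists D; intros [i [k j]] [x Hx] [y Hy]; exact (HD i k j x y Hx Hy).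
Qed.

Lemma asdim_diameter_function (Y : metric_family) (n : nat) :
  asdim_le Y n ->
  exists D : R -> R, forall r, 0 < r -> exists J U, decomposes Y n r (D r) J U.
Proof.
intros H; rewrite asdim_le_iff in H.
exists (fun r => epsilon (inhabits 0) (fun D => exists J U, decomposes Y n r D J U)).
intros r Hr; apply (epsilon_spec (inhabits 0) (fun D => exists J U, decomposes Y n r D J U)).
exact (H r Hr).
Qed.

(** * Gauges *)

Lemma least_nat (P : nat -> Prop) :
  (exists n, P n) -> exists n, P n /\ forall m, P m -> (n <= m)%nat.
Proof.
intros [n Hn].
destruct (dec_inh_nat_subset_has_unique_least_element P) as (k & [Hk Hmin] & _);
  [intros m; apply classic | now exists n | now exists k].
Qed.

Lemma nat_ceiling (t : R) : 0 <= t -> exists N : nat, t <= INR N <= t + 1.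
Proof.
intros Ht; destruct (archimed t) as [H1 H2].
destruct (IZN (up t)) as [N HN].
- apply le_IZR; lra.
- exists N; rewrite INR_IZR_INZ, <- HN; lra.
Qed.

(** [size v] is the distance below which two points of the base are neighbours
    at height [v], and [level t] is the height at which points at distance [t]
    become neighbours; by [level_le] the two functions are adjoint. *)
Record gauge := Gauge {
  size : nat -> R;
  level : R -> nat;
  size_ge1 : forall m, 1 <= size m;
  size_double : forall m, 2 * size m <= size (S m);
  level_le : forall t m, (level t <= m)%nat <-> t <= size m
}.

Lemma gauge_of_size (A : nat -> R) :
  (forall m, 1 <= A m) -> (forall m, 2 * A m <= A (S m)) ->
  exists G : gauge, size G = A.
Proof.
intros Apos Adouble.
assert (Amono : forall m n, (m <= n)%nat -> A m <= A n).
{ intros m n; induction 1 as [|n _ IH]; [lra|].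
  specialize (Apos n); specialize (Adouble n); lra. }
assert (Alarge : forall m, INR m <= A m).
{ induction m as [|m IH]; [specialize (Apos 0%nat); simpl; lra|].
  rewrite S_INR; specialize (Apos m); specialize (Adouble m); lra. }
assert (Hlevel : forall t, exists v, t <= A v /\ forall m, t <= A m -> (v <= m)%nat).
{ intros t; apply least_nat.
  destruct (INR_unbounded t) as [m Hm]; exists m; specialize (Alarge m); lra. }
set (lev := fun t => proj1_sig (constructive_indefinite_description _ (Hlevel t))).
assert (lev_le : forall t m, (lev t <= m)%nat <-> t <= A m).
{ intros t m; unfold lev.
  destruct constructive_indefinite_description as [v [Hv Hmin]]; simpl; split.
  - intros Hvm; specialize (Amono v m Hvm); lra.
  - apply Hmin. }
now exists (Gauge A lev Apos Adouble lev_le).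
Qed.

(** Each value of [size] is computed from the previous one, so it may exceed
    the value of [D] at the previous one: this is what lets the decomposition
    at one level have pieces that are small one level higher. *)
Lemma dominating_gauge (D rho : R -> R) :
  exists G : gauge,
    (forall m, D (size G m) <= size G (S m)) /\
    (forall m, rho (INR (2 * m)) <= size G m).
Proof.
set (A := nat_rect (fun _ => R) (1 + Rabs (rho (INR (2 * 0))))
  (fun m a => 2 * a + Rabs (D a) + Rabs (rho (INR (2 * S m))))).
assert (AS : forall m, A (S m) = 2 * A m + Rabs (D (A m)) + Rabs (rho (INR (2 * S m))))
  by reflexivity.
assert (A0 : A 0%nat = 1 + Rabs (rho (INR (2 * 0)))) by reflexivity.
clearbody A.
assert (Apos : forall m, 1 <= A m).
{ induction m as [|m IH].
  - rewrite A0; pose proof (Rabs_pos (rho (INR (2 * 0)))); lra.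
  - rewrite AS; pose proof (Rabs_pos (rho (INR (2 * S m))));
      pose proof (Rabs_pos (D (A m))); lra. }
destruct (gauge_of_size A) as [G HG]; trivial.
- intros m; rewrite AS; pose proof (Rabs_pos (rho (INR (2 * S m))));
    pose proof (Rabs_pos (D (A m))); lra.
- exists G; rewrite HG; split; intros m.
  + rewrite AS; pose proof (Rabs_pos (rho (INR (2 * S m))));
      pose proof (Rle_abs (D (A m))); specialize (Apos m); lra.
  + pose proof (Rle_abs (rho (INR (2 * m)))); destruct m as [|m].
    * rewrite A0; lra.
    * rewrite AS; pose proof (Rabs_pos (D (A m))); specialize (Apos m); lra.
Qed.

Lemma level_mono (G : gauge) (s t : R) : s <= t -> (level G s <= level G t)%nat.
Proof.
intros Hst; apply level_le.
assert (t <= size G (level G t)) by (apply level_le; lia); lra.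
Qed.

Lemma level_0 (G : gauge) : level G 0 = 0%nat.
Proof.
enough (level G 0 <= 0)%nat by lia.
apply level_le; pose proof (size_ge1 G 0); lra.
Qed.

(** Since [size] at least doubles from one height to the next, [level] turns
    the triangle inequality into an ultrametric one, with an error of [1]. *)
Lemma level_add (G : gauge) (s t : R) :
  (level G (s + t) <= S (Nat.max (level G s) (level G t)))%nat.
Proof.
set (m := Nat.max (level G s) (level G t)).
assert (Hs : s <= size G m) by (apply level_le; lia).
assert (Ht : t <= size G m) by (apply level_le; lia).
apply level_le; pose proof (size_double G m); lra.
Qed.

(** * Horoballs *)

Section Horoball.
Variables (G : gauge) (M : Metric_Space).

(** The summand [2] pays for the error in [level_add], and thus gives the
    triangle inequality.  The subtraction is never truncated. *)
Definition gap (p q : M * nat) : nat :=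
  2 * Nat.max (level G (dist M (fst p) (fst q))) (Nat.max (snd p) (snd q))
    - (snd p + snd q) + 2.

Definition horodist (p q : M * nat) : R :=
  if excluded_middle_informative (p = q) then 0 else INR (gap p q).

Lemma horodist_neq (p q : M * nat) : p <> q -> horodist p q = INR (gap p q).
Proof. unfold horodist; destruct excluded_middle_informative; tauto. Qed.

Lemma horodist_refl (p q : M * nat) : horodist p q = 0 <-> p = q.
Proof.
unfold horodist; destruct excluded_middle_informative as [E|E]; [tauto|].
split; [|tauto]; intros H; exfalso; revert H.
apply not_0_INR; unfold gap; lia.
Qed.

Lemma horodist_le_gap (p q : M * nat) : horodist p q <= INR (gap p q).
Proof.
unfold horodist; destruct excluded_middle_informative; [apply pos_INR | lra].
Qed.

Lemma horodist_pos (p q : M * nat) : horodist p q >= 0.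
Proof.
unfold horodist; destruct excluded_middle_informative; [lra|].
apply Rle_ge, pos_INR.
Qed.

Lemma horodist_sym (p q : M * nat) : horodist p q = horodist q p.
Proof.
destruct (classic (p = q)) as [->|H]; [trivial|].
rewrite !horodist_neq by congruence; f_equal; unfold gap.
rewrite (dist_sym M (fst p)), (Nat.max_comm (snd p)), (Nat.add_comm (snd p)).
reflexivity.
Qed.

Lemma gap_tri (p q r : M * nat) : (gap p q <= gap p r + gap r q)%nat.
Proof.
pose proof (level_mono G _ _ (dist_tri M (fst p) (fst q) (fst r))) as H1.
pose proof (level_add G (dist M (fst p) (fst r)) (dist M (fst r) (fst q))) as H2.
unfold gap; lia.
Qed.

Lemma horodist_tri (p q r : M * nat) :
  horodist p q <= horodist p r + horodist r q.
Proof.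
destruct (classic (p = r)) as [->|H1].
- pose proof (horodist_pos r r); lra.
- destruct (classic (r = q)) as [->|H2].
  + pose proof (horodist_pos q q); lra.
  + rewrite (horodist_neq p r), (horodist_neq r q) by trivial.
    rewrite <- plus_INR.
    apply Rle_trans with (1 := horodist_le_gap p q), le_INR, gap_tri.
Qed.

Definition horoball : Metric_Space :=
  Build_Metric_Space (M * nat) horodist
    horodist_pos horodist_sym horodist_refl horodist_tri.

End Horoball.

Definition horoball_family (G : gauge) (Y : metric_family) : metric_family :=
  MetricFamily (fun j : Y => horoball G (Y j)).

Lemma horoball_base_upper (G : gauge) (M : Metric_Space) (y z : M) :
  dist (horoball G M) (y, 0%nat) (z, 0%nat) <= INR (2 * level G (dist M y z) + 2).
Proof.
apply Rle_trans with (1 := horodist_le_gap _ _ _ _), le_INR; unfold gap; simpl; lia.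
Qed.

Lemma horoball_base_lower (G : gauge) (M : Metric_Space) (y z : M) :
  INR (level G (dist M y z)) <= dist (horoball G M) (y, 0%nat) (z, 0%nat).
Proof.
simpl; destruct (classic (y = z)) as [->|H].
- rewrite (proj2 (dist_refl M z z) eq_refl), level_0.
  pose proof (horodist_pos G M (z, 0%nat) (z, 0%nat)); simpl; lra.
- rewrite horodist_neq by congruence.
  apply le_INR; unfold gap; simpl; lia.
Qed.

(** * Asymptotic dimension of horoballs *)

Definition parity_colour {n : nat} (b : nat) (c : Fin.t (S n)) : Fin.t (S (n + S n)) :=
  if Nat.even b then Fin.L (S n) c else Fin.R (S n) c.

Lemma parity_colour_inj {n : nat} (b b' : nat) (c c' : Fin.t (S n)) :
  parity_colour b c = parity_colour b' c' -> Nat.even b = Nat.even b' /\ c = c'.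
Proof.
intros H.
apply (f_equal (fun k => proj1_sig (Fin.to_nat k))) in H.
pose proof (proj2_sig (Fin.to_nat c)) as Hc.
pose proof (proj2_sig (Fin.to_nat c')) as Hc'; simpl in Hc, Hc'.
unfold parity_colour in H.
destruct (Nat.even b), (Nat.even b').
- rewrite !(@Fin.L_sanity (S n) (S n)) in H; split; [trivial | now apply Fin.to_nat_inj].
- rewrite (@Fin.L_sanity (S n) (S n)), (@Fin.R_sanity (S n) (S n)) in H; lia.
- rewrite (@Fin.L_sanity (S n) (S n)), (@Fin.R_sanity (S n) (S n)) in H; lia.
- rewrite !(@Fin.R_sanity (S n) (S n)) in H; split; [trivial | apply Fin.to_nat_inj; lia].
Qed.

(** The bands are [N + 1] high, and the band [b] is decomposed by means of the
    pieces of [Y] at the level [m b], which lies [N] above the top of the band.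
    Two points of the band in distinct pieces of one colour become neighbours
    only above [m b], so the way from one to the other climbs more than [N] and
    descends more than [N]; two points in the same piece are neighbours at
    height [m b + 1], which is at most [2 * N + 2] above both. *)
Lemma horoball_family_asdim_le (G : gauge) (Y : metric_family) (n : nat) :
  (forall m, exists J U, decomposes Y n (size G m) (size G (S m)) J U) ->
  asdim_le (horoball_family G Y) (n + S n).
Proof.
intros HY; rewrite asdim_le_iff; intros r Hr.
destruct (nat_ceiling r) as (N & HN & _); [lra|].
set (w := S N).
set (m := fun b => (S b * w + N)%nat).
assert (exists (J : nat -> forall i : Y, Fin.t (S n) -> Type)
               (U : forall l (i : Y) (k : Fin.t (S n)), J l i k -> Y i -> Prop),
          forall l, decomposes Y n (size G l) (size G (S l)) (J l) (U l))
  as (J & U & HU).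
{ set (CJ := fun l => constructive_indefinite_description _ (HY l)).
  exists (fun l => proj1_sig (CJ l)).
  set (CU := fun l => constructive_indefinite_description _ (proj2_sig (CJ l))).
  exists (fun l => proj1_sig (CU l)); intros l; exact (proj2_sig (CU l)). }
exists (INR (2 * w + 2 * N + 4)),
  (fun (i : Y) _ => {b : nat & {c : Fin.t (S n) & J (m b) i c}}),
  (fun (i : Y) k a (p : Y i * nat) =>
     let b := projT1 a in let c := projT1 (projT2 a) in
     k = parity_colour b c /\ (b * w <= snd p < S b * w)%nat /\
     U (m b) i c (projT2 (projT2 a)) (fst p)).
split; [|split].
- intros i [y s].
  set (b := (s / w)%nat).
  destruct (proj1 (HU (m b)) i y) as (c & j & Hj).
  exists (parity_colour b c), (existT _ b (existT _ c j)); simpl; repeat split; trivial.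
  + unfold b; rewrite Nat.mul_comm; apply Nat.Div0.mul_div_le.
  + change (s < S b * w)%nat.
    rewrite Nat.mul_comm; apply Nat.mul_succ_div_gt; discriminate.
- intros i k [b [c j]] [b' [c' j']] p q Hneq; simpl.
  intros (-> & Hp & HUp) (Hcol & Hq & HUq).
  destruct (parity_colour_inj _ _ _ _ Hcol) as [Hpar <-].
  enough (p <> q /\ (N < gap G (Y i) p q)%nat) as [Hpq Hgap].
  { rewrite horodist_neq by trivial; apply lt_INR in Hgap; lra. }
  destruct (Nat.eq_dec b b') as [<-|Hb].
  + assert (Hj : j <> j') by congruence.
    pose proof (proj1 (proj2 (HU (m b))) i c j j' _ _ Hj HUp HUq) as Hd.
    split.
    * intros <-.
      rewrite (proj2 (dist_refl _ _ _) eq_refl) in Hd.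
      pose proof (size_ge1 G (m b)); lra.
    * assert (m b < level G (dist (Y i) (fst p) (fst q)))%nat.
      { apply Nat.nle_gt; rewrite level_le; lra. }
      unfold m in *; unfold gap; lia.
  + (* Bands of equal parity are separated by at least one whole band. *)
    assert (Hfar : (snd p + w < snd q \/ snd q + w < snd p)%nat).
    { assert (Hbb : (S (S b) <= b' \/ S (S b') <= b)%nat).
      { assert (b' <> S b).
        { intros ->; rewrite Nat.even_succ, <- Nat.negb_even in Hpar.
          destruct (Nat.even b); discriminate. }
        assert (b <> S b').
        { intros ->; rewrite Nat.even_succ, <- Nat.negb_even in Hpar.
          destruct (Nat.even b'); discriminate. }
        lia. }
      destruct Hbb as [Hbb|Hbb]; apply (Nat.mul_le_mono_r _ _ w) in Hbb; lia. }
    split; [intros <-; lia | unfold gap, w in *; lia].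
- intros i k [b [c j]] p q (_ & Hp & HUp) (_ & Hq & HUq).
  cbn [projT1 projT2] in *.
  apply Rle_trans with (1 := horodist_le_gap _ _ _ _), le_INR.
  pose proof (proj2 (proj2 (HU (m b))) i c j _ _ HUp HUq) as Hd.
  apply level_le in Hd.
  unfold m, w in *; unfold gap; lia.
Qed.

(** * Extension of coarse maps into horoballs *)

(** The bound [dist x x' + 4] has no factor because the climb from a height [s]
    to [(s + t + dist x x') / 2] and the descent to [t] add up to
    [dist x x']. *)
Lemma coarse_map_extends (G : gauge) (rho : R -> R) (X M : Metric_Space)
    (P : X -> Prop) (f : subspace X P -> M) :
  inhabited M ->
  (forall s t, 0 <= s -> s <= t -> rho s <= rho t) ->
  (forall m, rho (INR (2 * m)) <= size G m) ->
  (forall x y, dist M (f x) (f y) <= rho (dist (subspace X P) x y)) ->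
  exists g : X -> horoball G M,
    (forall x y, dist (horoball G M) (g x) (g y) <= dist X x y + 4) /\
    (forall x : subspace X P, g (proj1_sig x) = (f x, 0%nat)).
Proof.
intros [y0] rho_mono HG Hf.
destruct (classic (inhabited (subspace X P))) as [[x0]|Hempty].
2:{ exists (fun _ => (y0, 0%nat)); split.
    - intros x y; rewrite (proj2 (dist_refl (horoball G M) _ _) eq_refl).
      pose proof (dist_pos X x y); lra.
    - intros x; now destruct Hempty. }
assert (Hproj : forall x : X, exists a : nat * subspace X P,
  dist X x (proj1_sig (snd a)) <= INR (fst a) /\
  forall (n : nat) (z : subspace X P), dist X x (proj1_sig z) <= INR n -> (fst a <= n)%nat).
{ intros x.
  destruct (least_nat (fun n => exists z : subspace X P, dist X x (proj1_sig z) <= INR n))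
    as (n & [z Hz] & Hmin).
  - destruct (nat_ceiling (dist X x (proj1_sig x0))) as (n & Hn & _);
      [apply Rge_le, dist_pos | now exists n, x0].
  - exists (n, z); split; [trivial|]; intros n' z' H; apply Hmin; now exists z'. }
set (nearest := fun x => proj1_sig (constructive_indefinite_description _ (Hproj x))).
assert (Hnear : forall x, dist X x (proj1_sig (snd (nearest x))) <= INR (fst (nearest x)))
  by (intros x; exact (proj1 (proj2_sig (constructive_indefinite_description _ (Hproj x))))).
assert (Hmin : forall x n (z : subspace X P),
    dist X x (proj1_sig z) <= INR n -> (fst (nearest x) <= n)%nat)
  by (intros x; exact (proj2 (proj2_sig (constructive_indefinite_description _ (Hproj x))))).
clearbody nearest.
exists (fun x => (f (snd (nearest x)), fst (nearest x))); split.
- intros x y.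
  destruct (nat_ceiling (dist X x y)) as (N & HN & HN'); [apply Rge_le, dist_pos|].
  assert (height_lipschitz : forall u v, dist X u v <= INR N ->
            (fst (nearest u) <= fst (nearest v) + N)%nat).
  { intros u v Huv; apply (Hmin u _ (snd (nearest v))); rewrite plus_INR.
    pose proof (dist_tri X u (proj1_sig (snd (nearest v))) v); specialize (Hnear v); lra. }
  pose proof (height_lipschitz x y HN) as Hxy.
  assert (HN2 : dist X y x <= INR N) by (rewrite dist_sym; trivial).
  pose proof (height_lipschitz y x HN2) as Hyx.
  assert (Hp : dist (subspace X P) (snd (nearest x)) (snd (nearest y))
                 <= INR (fst (nearest x) + fst (nearest y) + N)).
  { rewrite !plus_INR.
    change (dist (subspace X P) (snd (nearest x)) (snd (nearest y)))
      with (dist X (proj1_sig (snd (nearest x))) (proj1_sig (snd (nearest y)))).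
    pose proof (Hnear x) as Hx; rewrite dist_sym in Hx; pose proof (Hnear y) as Hy.
    pose proof (dist_tri X (proj1_sig (snd (nearest x))) (proj1_sig (snd (nearest y))) x).
    pose proof (dist_tri X x (proj1_sig (snd (nearest y))) y); lra. }
  specialize (Hf (snd (nearest x)) (snd (nearest y))).
  set (s := fst (nearest x)) in *; set (t := fst (nearest y)) in *.
  assert (exists v, (s + t + N <= 2 * v <= s + t + N + 1)%nat) as [v Hv].
  { exists ((s + t + N + 1) / 2)%nat.
    pose proof (Nat.div_mod_eq (s + t + N + 1) 2).
    pose proof (Nat.mod_upper_bound (s + t + N + 1) 2); lia. }
  assert (Hlev : (level G (dist M (f (snd (nearest x))) (f (snd (nearest y)))) <= v)%nat).
  { apply level_le, Rle_trans with (1 := Hf), Rle_trans with (2 := HG v).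
    apply rho_mono; [apply Rge_le, dist_pos|].
    apply Rle_trans with (1 := Hp), le_INR; lia. }
  apply Rle_trans with (1 := horodist_le_gap _ _ _ _).
  apply Rle_trans with (INR (N + 3)).
  + apply le_INR; unfold gap; cbn [fst snd]; lia.
  + rewrite plus_INR; simpl; lra.
- intros x.
  assert (Hx : dist X (proj1_sig x) (proj1_sig x) <= INR 0).
  { rewrite (proj2 (dist_refl X _ _) eq_refl); simpl; lra. }
  pose proof (Hmin (proj1_sig x) 0%nat x Hx) as H0.
  pose proof (Hnear (proj1_sig x)) as Hd.
  replace (fst (nearest (proj1_sig x))) with 0%nat in * by lia.
  replace (snd (nearest (proj1_sig x))) with x; trivial.
  apply (dist_refl (subspace X P)).
  pose proof (dist_pos (subspace X P) x (snd (nearest (proj1_sig x)))).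
  simpl in *; lra.
Qed.

(** * Adding a point for empty members *)

Definition point : Metric_Space.
Proof.
refine (Build_Metric_Space unit (fun _ _ => 0) _ _ _ _); intros; try lra.
destruct x, y; split; trivial.
Defined.

Definition with_point (Y : metric_family) : metric_family :=
  MetricFamily (fun k : option Y =>
    match k with Some j => Y j | None => point end).

Lemma with_point_asdim_le (Y : metric_family) (n : nat) :
  asdim_le Y n -> asdim_le (with_point Y) n.
Proof.
rewrite !asdim_le_iff; intros H r Hr.
destruct (H r Hr) as (D & J & U & Hcov & Hsep & HD).
set (J' := fun i : with_point Y =>
  match i return Fin.t (S n) -> Type with Some j => J j | None => fun _ => unit end).
exists (Rmax D 0), J',
  (fun i => match i return forall k, J' i k -> with_point Y i -> Prop with
            | Some j => U j
            | None => fun _ _ _ => True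
            end).
split; [|split]; intros [i|]; simpl.
- apply Hcov.
- intros _; now exists Fin.F1, tt.
- apply Hsep.
- intros _ [] [] _ _ []; trivial.
- intros k j x y Hx Hy; apply Rle_trans with (2 := Rmax_l _ _); eauto.
- intros _ _ _ _ _ _; apply Rmax_r.
Qed.

Inductive base_inclusion_in (G : gauge) (Y : metric_family) :
    forall (j : Y) (k : with_point (horoball_family G Y)),
      (Y j -> with_point (horoball_family G Y) k) -> Prop :=
| base_inclusion_nonempty (j : Y) :
    inhabited (Y j) ->
    base_inclusion_in G Y j (Some j) (fun y => (y, 0%nat))
| base_inclusion_empty (j : Y) :
    ~ inhabited (Y j) ->
    base_inclusion_in G Y j None (fun _ => tt).

Lemma base_inclusion_total (G : gauge) (Y : metric_family) (j : Y) :
  exists k th, base_inclusion_in G Y j k th.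
Proof.
destruct (classic (inhabited (Y j))) as [H|H].
- exists (Some j), (fun y => (y, 0%nat)); now constructor.
- exists None, (fun _ => tt); now constructor.
Qed.

Definition base_inclusion (G : gauge) (Y : metric_family) :
    family_map Y (with_point (horoball_family G Y)) :=
  FamilyMap Y (with_point (horoball_family G Y))
    (base_inclusion_in G Y) (base_inclusion_total G Y).

Lemma base_inclusion_coarse_embedding (G : gauge) (Y : metric_family) :
  coarse_embedding (base_inclusion G Y).
Proof.
split.
- exists (fun t => INR (2 * level G t + 2)); split; [split|].
  + intros; apply pos_INR.
  + intros s t _ Hst; apply le_INR; pose proof (level_mono G s t Hst); lia.
  + intros j k th [j' Hj|j' Hj] y z; [apply horoball_base_upper | now destruct Hj].
- exists (fun t => INR (level G t)); split; [split|split].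
  + intros; apply pos_INR.
  + intros s t _ Hst; apply le_INR, level_mono, Hst.
  + intros B.
    destruct (INR_unbounded B) as [n Hn].
    exists (size G n); intros t _ Ht.
    apply level_le, INR_le; lra.
  + intros j k th [j' Hj|j' Hj] y z; [apply horoball_base_lower | now destruct Hj].
Qed.

(** * Extension of maps of families *)

Lemma family_map_extends (G : gauge) (rho : R -> R) (X Y : metric_family)
    (P : forall i : X, X i -> Prop) (F : family_map (subspace_family X P) Y) :
  (forall s t, 0 <= s -> s <= t -> rho s <= rho t) ->
  (forall m, rho (INR (2 * m)) <= size G m) ->
  (forall (i : X) (j : Y) (f : subspace (X i) (P i) -> Y j), F i j f ->
     forall x y, dist (Y j) (f x) (f y) <= rho (dist (subspace (X i) (P i)) x y)) ->
  forall (i : X) (k : with_point (horoball_family G Y)) g,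
    family_comp (base_inclusion G Y) F i k g ->
    exists h : X i -> with_point (horoball_family G Y) k,
      (forall x y, dist _ (h x) (h y) <= dist (X i) x y + 4) /\
      (forall x : subspace (X i) (P i), h (proj1_sig x) = g x).
Proof.
intros rho_mono HG HF i k g (j & f & th & Hf & Hth & ->).
destruct Hth as [j Hj|j Hj].
- exact (coarse_map_extends G rho (X i) (Y j) (P i) f Hj rho_mono HG (HF i j f Hf)).
- exists (fun _ => tt); split; [|trivial].
  intros x y; pose proof (dist_pos (X i) x y); simpl; lra.
Qed.

Theorem theorem4p1
    (X : metric_family) (X0 X1 : forall i : X, X i -> Prop)
    (decomposition : forall (i : X) (x : X i), X0 i x \/ X1 i x)
    (Y : metric_family) (Y_asdim : finite_asdim Y)
    (F : family_map (subspace_family X X0) Y) (F_coarse : coarse F) :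
  exists (Y' : metric_family) (Theta : family_map Y Y') (F' : family_map X Y'),
    finite_asdim Y' /\ coarse_embedding Theta /\ coarse F' /\
    close (family_comp Theta F) (family_restrict X0 F').
Proof.
destruct Y_asdim as [n Hn].
destruct F_coarse as (rho & [_ rho_mono] & HF).
destruct (asdim_diameter_function Y n Hn) as [D HD].
destruct (dominating_gauge D rho) as (G & HGD & HGrho).
set (Y' := with_point (horoball_family G Y)).
set (Theta := base_inclusion G Y).
pose proof (family_map_extends G rho X Y X0 F rho_mono HGrho HF) as Hext.
(* Taking all extensions with the uniform bound makes closeness hold in both
   directions without selecting one extension for each map. *)
set (F'_in := fun (i : X) (k : Y') (h : X i -> Y' k) =>
  (forall x y, dist (Y' k) (h x) (h y) <= dist (X i) x y + 4) /\
  exists g, family_comp Theta F i k g /\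
    forall x : subspace (X i) (X0 i), h (proj1_sig x) = g x).
assert (F'_total : forall i, exists k h, F'_in i k h).
{ intros i; destruct (map_total (family_comp Theta F) i) as (k & g & Hg).
  destruct (Hext i k g Hg) as (h & Hh & Hhg).
  exists k, h; split; [exact Hh | now exists g]. }
exists Y', Theta, (FamilyMap X Y' F'_in F'_total); split; [|split; [|split]].
- exists (n + S n)%nat.
  apply with_point_asdim_le, horoball_family_asdim_le; intros m.
  destruct (HD (size G m)) as (J & U & Hcov & Hsep & Hdiam).
  { pose proof (size_ge1 G m); lra. }
  exists J, U; repeat split; trivial.
  intros i k j x y Hx Hy; apply Rle_trans with (2 := HGD m); eauto.
- apply base_inclusion_coarse_embedding.
- exists (fun t => t + 4); split; [split; intros; lra|].
  intros i k h [Hh _]; exact Hh.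
- exists 0; split; [lra|split].
  + intros i k g Hg.
    destruct (Hext i k g Hg) as (h & Hh & Hhg).
    exists (fun x => h (proj1_sig x)); split.
    * exists h; split; [|trivial]; split; [exact Hh | now exists g].
    * intros x; rewrite Hhg; apply Req_le, dist_refl; trivial.
  + intros i k _ (h & (_ & g & Hg & Hhg) & ->).
    exists g; split; [exact Hg|].
    intros x; rewrite Hhg; apply Req_le, dist_refl; trivial.
Qed.
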